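(* Let $M_k$ denote a matching with $k$ edges. For all positive integers $k$ and $n$ with $n\ge 9k^2$, \[ \mathrm{ex}^*(n,M_k)=\binom{k-1}{2}+(k-1)(n-k+1). \]
   Context: For a fixed graph $F$, $\mathrm{ex}^*(n,F)$ (the rainbow Turán number of $F$) is the maximum number of edges in a graph on $n$ vertices that admits a proper edge-coloring containing no rainbow copy of $F$. A rainbow copy of $F$ is a copy of $F$ all of whose edges receive different colors. *)

(* Defs.v *)
From HB Require Import structures.
From mathcomp Require Import all_boot boolp.

Set Implicit Arguments.
Unset Strict Implicit.
Unset Printing Implicit Defensive.

Record sgraph (T : finType) := SGraph {
  edges : {set {set T}};
  edges_card2 : [forall e in edges, #|e| == 2]
}.

HB.instance Definition _ (T : finType) := [isSub for @edges T].
HB.instance Definition _ (T : finType) := [Finite of sgraph T by <:].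

Section Rainbow.
Variables (U T : finType) (F : sgraph U) (G : sgraph T).

(* The graphs are finite, so nat provides as many colours as are ever needed;
   the values of c outside edges G are irrelevant. *)
Definition proper_edge_coloring (c : {set T} -> nat) : Prop :=
  forall e e', e \in edges G -> e' \in edges G ->
    e != e' -> e :&: e' != set0 -> c e != c e'.

(* Not necessarily induced. *)
Definition is_copy (f : U -> T) : Prop :=
  injective f /\ forall e, e \in edges F -> f @: e \in edges G.

Definition is_rainbow_copy (c : {set T} -> nat) (f : U -> T) : Prop :=
  is_copy f /\ {in edges F &, injective (fun e : {set U} => c (f @: e))}.

Definition rainbow_avoidable : Prop :=
  exists2 c, proper_edge_coloring c & ~ exists f, is_rainbow_copy c f.

End Rainbow.

(* The graphs on n labelled vertices form a finite type, so the maximum exists.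
   It is 0 by convention when no graph qualifies, which requires F to have no
   edges, since otherwise the edgeless graph qualifies. *)
Definition ex_star (n : nat) (U : finType) (F : sgraph U) : nat :=
  \max_(G : sgraph 'I_n | `[< rainbow_avoidable F G >]) #|edges G|.

Definition matching_edges (k : nat) : {set {set 'I_k * bool}} :=
  [set [set (i, false); (i, true)] | i : 'I_k].

Lemma matching_edges_card2 (k : nat) :
  [forall e in matching_edges k, #|e| == 2].
Proof.
by apply/forall_inP => e /imsetP[i _ ->]; rewrite cards2 xpair_eqE andbF.
Qed.

Definition matching (k : nat) : sgraph ('I_k * bool)%type :=
  SGraph (matching_edges_card2 k).

(* Main.v *)
(* Lower bound: when k-1 vertices meet every edge, no k edges are pairwise
   disjoint.

   Upper bound, by induction on k.  Any set of more than 3(k-1) edges at a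
   vertex v contains one that extends a given rainbow (k-1)-matching avoiding v,
   as at most 2(k-1) of them meet the matching and at most k-1 repeat a colour;
   so v can be deleted, together with at most n-1 edges.  If instead all degrees
   are at most 3(k-1), take a maximal rainbow matching, with at most k-1 edges.
   Every edge meets it, which accounts for at most 6(k-1)^2 edges, or repeats
   one of its colours, which accounts for at most (k-1)n/2 edges. *)
Require Import Defs.
From mathcomp Require Import all_boot.
From mathcomp Require Import boolp zify.

Set Implicit Arguments.
Unset Strict Implicit.
Unset Printing Implicit Defensive.

(** * Counting lemmas and the numerical estimate *)

Lemma leq_card_bigcup (T I : finType) (A : {set I}) (F : I -> {set T}) (d : nat) :
  {in A, forall i, #|F i| <= d} -> #|\bigcup_(i in A) F i| <= #|A| * d.
Proof.
move=> hF; rewrite -sum_nat_const.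
apply: (@leq_trans (\sum_(i in A) #|F i|)); last exact: leq_sum.
elim/big_rec2: _ => [|i m B _ hB]; first by rewrite cards0.
by apply: leq_trans (leq_card_setU _ _) _; rewrite leq_add2l.
Qed.

(** An edge at [v] is determined by its other endpoint, which lies in [X]. *)
Lemma leq_card_star (T : finType) (D : {set {set T}}) (X : {set T}) (v : T) :
  {in D, forall e : {set T}, [/\ #|e| = 2, v \in e & exists2 x, x \in e :\ v & x \in X]} ->
  #|D| <= #|X|.
Proof.
move=> hD; apply: leq_trans (leq_imset_card (fun x => [set v; x]) X).
apply: subset_leq_card; apply/subsetP => e /hD[e2 ve [x]].
rewrite !inE => /andP[xv xe] xX; apply/imsetP; exists x => //.
apply/esym/eqP; rewrite eqEcard e2 cards2 eq_sym xv andbT.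
by apply/subsetP => y /set2P[]->.
Qed.

Lemma card_cover_uniform (T : finType) (M : {set {set T}}) (d : nat) :
  trivIset M -> {in M, forall e : {set T}, #|e| = d} -> #|cover M| = #|M| * d.
Proof. by move=> /eqP<- hM; rewrite (eq_bigr _ hM) sum_nat_const. Qed.

(** The estimate that closes the low-degree case, with degrees at most [3 * j] on [s] vertices. Both
    sides are doubled to avoid halves; cancelling a factor [j] leaves the linear inequality [hsub],
    which the quadratic lower bound on [s] supplies. *)
Lemma low_degree_bound (j s : nat) :
  9 * j.+1 ^ 2 <= s -> 4 * j * (3 * j) + j * s <= 2 * ('C(j, 2) + j * (s - j)).
Proof.
move=> hs.
have hsub : 13 * j <= j.-1 + (s - j) by move: hs; rewrite expnS expn1; nia.
have hbin : 2 * 'C(j, 2) = j * j.-1 by rewrite -mul_bin_diag bin1.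
have := leq_mul (leqnn j) hsub.
have -> : j * s = j * (s - j) + j * j by rewrite -mulnDr subnK //; nia.
lia.
Qed.

(** * Rainbow matchings in a properly coloured edge set *)

Section RainbowMatching.
Variables (T : finType) (c : {set T} -> nat).

Definition rainbow_matching (M : {set {set T}}) : bool :=
  trivIset M && dinjectiveb c M.

Lemma rainbow_matching0 : rainbow_matching set0.
Proof.
by apply/andP; split; [apply/trivIsetP => ? ?|apply/dinjectiveP => ? ?]; rewrite inE.
Qed.

Lemma rainbow_matchingS (M N : {set {set T}}) :
  N \subset M -> rainbow_matching M -> rainbow_matching N.
Proof.
move=> /subsetP NM /andP[tM /dinjectiveP iM]; apply/andP; split.
  by apply: trivIsetS tM; apply/subsetP.
by apply/dinjectiveP => x y /NM xM /NM; apply: iM.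
Qed.

Lemma rainbow_matchingU1 (M : {set {set T}}) (e : {set T}) :
  rainbow_matching M -> [disjoint e & cover M] ->
  {in M, forall g : {set T}, c e != c g} -> rainbow_matching (e |: M).
Proof.
move=> /andP[/trivIsetP tM /dinjectiveP iM] eM ceM.
have edisj g : g \in M -> [disjoint e & g].
  by move=> gM; apply: disjointWr eM; apply: bigcup_sup.
apply/andP; split.
  apply/trivIsetP => x y /setU1P[->|xM] /setU1P[->|yM]; first by rewrite eqxx.
  - by move=> _; apply: edisj.
  - by move=> _; rewrite disjoint_sym; apply: edisj.
  - exact: tM.
apply/dinjectiveP => x y /setU1P[->|xM] /setU1P[->|yM] // cxy.
- by move: (ceM _ yM); rewrite cxy eqxx.
- by move: (ceM _ xM); rewrite cxy eqxx.
- exact: iM.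
Qed.

Definition proper_on (E : {set {set T}}) : Prop :=
  {in E &, forall e g : {set T}, e != g -> c e = c g -> [disjoint e & g]}.

Definition star (E : {set {set T}}) (v : T) : {set {set T}} :=
  [set e in E | v \in e].

Definition color_class (E : {set {set T}}) (a : nat) : {set {set T}} :=
  [set e in E | c e == a].

(** Properness makes a colour class a matching, so it covers two vertices of [S] per edge. *)
Lemma card_color_class (S : {set T}) (E : {set {set T}}) (a : nat) :
  {in E, forall e : {set T}, #|e| = 2 /\ e \subset S} -> proper_on E ->
  #|color_class E a| * 2 <= #|S|.
Proof.
move=> hE pE; rewrite -card_cover_uniform.
- apply: subset_leq_card; apply/bigcupsP => e.
  by rewrite inE => /andP[/hE[]].
- apply/trivIsetP => e g; rewrite !inE => /andP[eE /eqP ea] /andP[gE /eqP ga].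
  by move=> eg; apply: pE => //; rewrite ea ga.
- by move=> e; rewrite inE => /andP[/hE[]].
Qed.

Lemma extend_by_star (E M : {set {set T}}) (v : T) :
  {in E, forall e : {set T}, #|e| = 2} -> proper_on E ->
  M \subset E -> rainbow_matching M -> v \notin cover M ->
  3 * #|M| < #|star E v| ->
  exists2 e, e \in star E v & rainbow_matching (e |: M).
Proof.
move=> hE pE /subsetP ME rM vM hv.
pose touching := [set e in star E v | ~~ [disjoint e & cover M]].
pose repeating := \bigcup_(g in M) color_class (star E v) (c g).
have touching_le : #|touching| <= #|M| * 2.
  have /andP[tM _] := rM.
  rewrite -card_cover_uniform //; last by move=> e /ME /hE.
  (* Since [M] does not cover [v], such an edge meets [cover M] in its other endpoint. *)
  apply: (@leq_card_star _ _ _ v) => e; rewrite !inE => /andP[/andP[eE ve]].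
  case/pred0Pn => x /andP[/= xe xM]; split=> //; first exact: hE.
  exists x => //; rewrite !inE xe andbT.
  by apply: contraNneq vM => <-.
have repeating_le : #|repeating| <= #|M| * 1.
  (* Edges at [v] share [v], so at most one of them has any given colour. *)
  apply: leq_card_bigcup => g gM; apply/card_le1_eqP => e f.
  rewrite !inE => /andP[/andP[eE ve] /eqP ce] /andP[/andP[fE vf] /eqP cf].
  apply/eqP/negPn/negP => ef.
  have /pred0P/(_ v) : [disjoint e & f] by apply: pE; rewrite 1?eq_sym ?ce ?cf.
  by rewrite /= ve vf.
have : ~~ (star E v \subset touching :|: repeating).
  apply/negP => /subset_leq_card.
  have [h _] := leq_card_setU touching repeating.
  move=> /leq_trans/(_ h); lia.
case/subsetPn => e ev; rewrite !inE negb_or => /andP[].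
rewrite inE in ev; rewrite ev /= negbK => edisj /bigcupP enew.
exists e; first by rewrite inE.
apply: rainbow_matchingU1 => // g gM; apply/negP => /eqP ceg.
by apply: enew; exists g => //; rewrite !inE ev ceg eqxx.
Qed.

(** The degree bound [d] is left free so that the base case [j = 0] of the induction is covered too:
    there the terms in [d] and [#|S|] vanish. *)
Lemma rainbow_matching_low_degree (j d : nat) (S : {set T}) (E : {set {set T}}) :
  {in E, forall e : {set T}, #|e| = 2 /\ e \subset S} -> proper_on E ->
  (forall v, #|star E v| <= d) ->
  4 * j * d + j * #|S| < 2 * #|E| ->
  exists M : {set {set T}}, [/\ M \subset E, rainbow_matching M & #|M| = j.+1].
Proof.
move=> hE pE hd hcard.
pose P (M : {set {set T}}) := (M \subset E) && rainbow_matching M.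
have P0 : P set0 by rewrite /P sub0set rainbow_matching0.
case: (arg_maxnP (fun M : {set {set T}} => #|M|) P0) => M /andP[ME rM] Mmax.
case: (ltnP j #|M|) => [jM|Mj].
  (* A matching with more than [j] edges has a subset of exactly [j.+1], as the binomial coefficient
     counting these is positive. *)
  have : 0 < #|[set N : {set {set T}} | N \subset M & #|N| == j.+1]|.
    by rewrite cards_draws bin_gt0.
  case/card_gt0P => N; rewrite inE => /andP[NM /eqP Nj].
  exists N; split=> //; first exact: subset_trans ME.
  exact: rainbow_matchingS rM.
pose touching := \bigcup_(v in cover M) star E v.
pose repeating := \bigcup_(g in M) color_class E (c g).
have touching_le : #|touching| <= #|M| * 2 * d.
  have /andP[tM _] := rM.
  rewrite -card_cover_uniform //; last first.
    by move=> e /(subsetP ME) /hE[].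
  exact: leq_card_bigcup.
have repeating_le : #|repeating| <= #|M| * (#|S| %/ 2).
  apply: leq_card_bigcup => g gM.
  by rewrite leq_divRL //; apply: card_color_class.
(* By maximality of [M]: an edge outside both sets could be added to it. *)
have Esub : E \subset touching :|: repeating.
  apply/subsetP => e eE; apply/negPn/negP; rewrite inE negb_or.
  case/andP => /bigcupP etouch /bigcupP erep.
  have edisj : [disjoint e & cover M].
    apply/pred0P => v; apply/negP => /andP[/= ve vM].
    by apply: etouch; exists v => //; rewrite inE eE.
  have enew : {in M, forall g : {set T}, c e != c g}.
    move=> g gM; apply/negP => /eqP ceg.
    by apply: erep; exists g => //; rewrite inE eE ceg eqxx.
  (* Adding [e] must strictly enlarge [M]; if [e] were in [M], its colour would differ from
     itself. *)
  have eM : e \notin M by apply/negP => /enew; rewrite eqxx.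
  have /Mmax : P (e |: M).
    rewrite /P rainbow_matchingU1 // andbT.
    by apply/subsetP => g /setU1P[->|/(subsetP ME)].
  by rewrite cardsU1 eM /= ltnn.
have [h _] := leq_card_setU touching repeating.
have := leq_trans (subset_leq_card Esub) h.
have hS : #|S| %/ 2 * 2 <= #|S| by rewrite leq_divM.
have h1 : #|M| * 2 * d <= j * 2 * d by rewrite !leq_mul.
have h2 : #|M| * (#|S| %/ 2) <= j * (#|S| %/ 2) by rewrite leq_mul.
nia.
Qed.

(** The vertex set [S] is a parameter so that the induction can delete a vertex without changing the
    type [T]. *)
Lemma rainbow_matching_exists (j : nat) (S : {set T}) (E : {set {set T}}) :
  {in E, forall e : {set T}, #|e| = 2 /\ e \subset S} -> proper_on E ->
  9 * j.+1 ^ 2 <= #|S| -> 'C(j, 2) + j * (#|S| - j) < #|E| ->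
  exists M : {set {set T}}, [/\ M \subset E, rainbow_matching M & #|M| = j.+1].
Proof.
elim: j S E => [|j IH] S E hE pE hS hcard.
  apply: (@rainbow_matching_low_degree 0 #|E| S) => //; last by lia.
  by move=> v; apply: subset_leq_card; apply/subsetP => e; rewrite inE => /andP[].
have [/existsP[v hv]|/existsPn low] := boolP [exists v, 3 * j.+1 < #|star E v|]; last first.
  apply: (@rainbow_matching_low_degree j.+1 (3 * j.+1) S) => //.
    by move=> v; rewrite leqNgt.
  by apply: leq_ltn_trans (low_degree_bound hS) _; rewrite ltn_pmul2l.
(* A nonempty star forces [v] into [S], so deleting [v] does shrink [S]. *)
have [e0 e0v] : exists e, e \in star E v by apply/card_gt0P; lia.
have vS : v \in S.
  by move: e0v; rewrite inE => /andP[/hE[_ /subsetP]] eS /eS.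
have hstar : #|star E v| <= #|S :\ v|.
  apply: (@leq_card_star _ _ _ v) => e; rewrite inE => /andP[/hE[e2 eS] ve].
  split=> //; have /card_gt0P[x xe] : 0 < #|e :\ v| by move: e2; rewrite (cardsD1 v) ve; lia.
  by exists x => //; apply: subsetP (setSD _ eS) _ xe.
have hSv : #|S| = #|S :\ v|.+1 by rewrite (cardsD1 v) vS.
have hEv : #|E| = #|star E v| + #|E :\: star E v|.
  rewrite -(cardsID (star E v) E) (setIidPr _) //.
  by apply/subsetP => e; rewrite inE => /andP[].
have [||||M [ME rM Mj]] := IH (S :\ v) (E :\: star E v).
- move=> e; rewrite !inE negb_and => /andP[h eE]; have [e2 eS] := hE _ eE.
  split=> //; rewrite subsetD1 eS /=; by move: h; rewrite eE.
- by move=> e g /setDP[eE _] /setDP[gE _]; apply: pE.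
- nia.
(* By Pascal's rule the edge bound drops by exactly [#|S| - 1], the most edges that [v] can carry
   away. *)
- move: hcard; rewrite binS bin1; nia.
have MsubE : M \subset E by apply: subset_trans ME (subsetDl _ _).
have vM : v \notin cover M.
  apply/bigcupP => -[e /(subsetP ME)]; rewrite !inE => /andP[+ eE] ve.
  by rewrite eE ve.
have E2 : {in E, forall e : {set T}, #|e| = 2} by move=> e /hE[].
have [|e ev reM] := extend_by_star E2 pE MsubE rM vM; first by rewrite Mj.
move: (ev); rewrite inE => /andP[eE ve].
exists (e |: M); split=> //.
  by apply/subsetP => g /setU1P[->|/(subsetP MsubE)].
rewrite cardsU1 Mj; case: (boolP (e \in M)) => // eM.
by case/bigcupP: vM; exists e.
Qed.

End RainbowMatching.

(** * Passing between sets of edges and copies of a matching *)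

Lemma rainbow_copy_of_matching (T : finType) (G : sgraph T) (c : {set T} -> nat)
    (k : nat) (M : {set {set T}}) :
  M \subset edges G -> rainbow_matching c M -> #|M| = k ->
  exists f, is_rainbow_copy (matching k) G c f.
Proof.
move=> /subsetP MG /andP[/trivIsetP tM /dinjectiveP iM] Mk; subst k.
(* Ordering the endpoints of each edge of [M] defines the embedding. *)
have [p hp] : exists p : 'I_#|M| -> T * T,
    forall i, (p i).1 != (p i).2 /\ enum_val i = [set (p i).1; (p i).2].
  apply: (@fin_all_exists _ (fun=> (T * T)%type) (fun i q => q.1 != q.2 /\ enum_val i = [set q.1; q.2])) => i.
  have /(forall_inP (edges_card2 G)) := MG _ (enum_valP i).
  by case/cards2P => x [y [xy ->]]; exists (x, y).
pose f (u : 'I_#|M| * bool) := if u.2 then (p u.1).2 else (p u.1).1.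
have fE i : f @: [set (i, false); (i, true)] = enum_val i.
  by rewrite imsetU1 imset_set1 (hp i).2.
have fin i b : f (i, b) \in enum_val i.
  by rewrite (hp i).2 /f; case: b; rewrite !inE eqxx ?orbT.
exists f; split; first split.
- move=> [i a] [j b] fij.
  have ij : i = j.
    apply/enum_val_inj/eqP/negPn/negP => /(tM _ _ (enum_valP i) (enum_valP j)).
    by move=> /pred0P/(_ (f (i, a))) /=; rewrite fin fij fin.
  move: fij; rewrite -ij /f /=.
  by case: a b => -[] //= fij; case/eqP: (hp i).1; rewrite fij.
- by move=> e /imsetP[i _ ->]; rewrite fE; apply/MG/enum_valP.
- move=> e g /imsetP[i _ ->] /imsetP[j _ ->] /=; rewrite !fE => cij.
  by rewrite (enum_val_inj (iM _ _ (enum_valP i) (enum_valP j) cij)).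
Qed.

(** Each edge of the copy has an endpoint in [A], and these endpoints are distinct because the edges
    are disjoint. *)
Lemma matching_copy_leq_vertex_cover (T : finType) (G : sgraph T) (A : {set T})
    (k : nat) (f : 'I_k * bool -> T) :
  {in edges G, forall e : {set T}, e :&: A != set0} -> is_copy (matching k) G f -> k <= #|A|.
Proof.
move=> hA [injf hf].
have [b hb] : exists b : 'I_k -> bool, forall i, f (i, b i) \in A.
  apply: (@fin_all_exists _ (fun=> bool) (fun i b => f (i, b) \in A)) => i.
  have /hf/hA/set0Pn[x] : [set (i, false); (i, true)] \in edges (matching k).
    exact: imset_f.
  by rewrite inE => /andP[/imsetP[u /set2P[]-> ->]]; [exists false|exists true].
have injg : injective (fun i => f (i, b i)) by move=> i j /injf[].
rewrite -[k]card_ord -cardsT -(card_imset _ injg); apply: subset_leq_card.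
by apply/subsetP => _ /imsetP[i _ ->].
Qed.

(** * The extremal graph: the join of a clique on [A] and an independent set *)

Definition edges_meeting (T : finType) (A : {set T}) : {set {set T}} :=
  [set e : {set T} | #|e| == 2 & e :&: A != set0].

Lemma edges_meeting_card2 (T : finType) (A : {set T}) :
  [forall e in edges_meeting A, #|e| == 2].
Proof. by apply/forall_inP => e; rewrite inE => /andP[]. Qed.

(** Complementary counting: from all pairs, remove those inside the complement of [A]. *)
Lemma card_edges_meeting (T : finType) (A : {set T}) :
  #|edges_meeting A| = 'C(#|A|, 2) + #|A| * #|~: A|.
Proof.
pose D (X : {set T}) := [set e : {set T} | e \subset X & #|e| == 2].
have : #|D setT| = #|edges_meeting A| + #|D (~: A)|.
  rewrite -(cardsID (edges_meeting A) (D setT)); congr (_ + _).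
    by apply: eq_card => e; rewrite !inE subsetT; case: (#|e| == 2).
  apply: eq_card => e; rewrite !inE subsetT /= negb_and negbK.
  by rewrite setI_eq0 disjoints_subset; case: (#|e| == 2); rewrite ?andbT ?andbF.
rewrite !cards_draws cardsT -(cardsC A) addnC.
set a := #|A|; set b := #|~: A| => h.
have binom2D : 'C(b + a, 2) = 'C(b, 2) + 'C(a, 2) + a * b.
  by elim: (a) => [|m IH]; rewrite ?addn0 // addnS !binS !bin1 IH; lia.
by move: h; rewrite binom2D; lia.
Qed.

Theorem theorem2 (k n : nat) (hk : 0 < k) (hn : 9 * k ^ 2 <= n) :
  ex_star n (matching k) = 'C(k - 1, 2) + (k - 1) * (n - k + 1).
Proof.
case: k hk hn => // j _ hn; rewrite subSS subn0.
have -> : n - j.+1 + 1 = n - j by nia.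
apply/eqP; rewrite eqn_leq; apply/andP; split.
  apply/bigmax_leqP => G /asboolP[c pc norainbow]; rewrite leqNgt; apply/negP => hG.
  have [||||M [ME rM Mk]] :=
    @rainbow_matching_exists _ c j [set: 'I_n] (edges G).
  - by move=> e /(forall_inP (edges_card2 G))/eqP; split=> //; apply: subsetT.
  - move=> e g eG gG eg ceg; rewrite -setI_eq0; apply/negPn/negP => meet.
    by move: (pc _ _ eG gG eg meet); rewrite ceg eqxx.
  - by rewrite cardsT card_ord.
  - by rewrite cardsT card_ord.
  exact: norainbow (rainbow_copy_of_matching ME rM Mk).
have jn : j <= n by nia.
(* The cover consists of the first [j] vertices, that is, one fewer than the edges of the forbidden
   matching. *)
pose A := [set widen_ord jn i | i : 'I_j].
have cardA : #|A| = j.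
  rewrite card_imset ?card_ord // => x y /(congr1 val) xy; exact: val_inj.
have cardAC : #|~: A| = n - j by rewrite cardsCs setCK card_ord cardA.
rewrite -{1 2}cardA -cardAC -card_edges_meeting.
pose G := SGraph (edges_meeting_card2 A).
apply: (@leq_bigmax_cond _ _ (fun G : sgraph 'I_n => #|edges G|) G).
(* Giving every set its own colour is trivially proper; this graph contains no copy of the matching
   at all, rainbow or not. *)
apply/asboolP; exists (fun e => val (enum_rank e)).
  by move=> e g _ _ eg _; apply: contra eg => /eqP/val_inj/enum_rank_inj->.
move=> [f [/(@matching_copy_leq_vertex_cover _ G A) h _]].
suff : j.+1 <= #|A| by rewrite cardA ltnn.
by apply: h => e; rewrite inE => /andP[].
Qed.
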